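(* Let $G_1,G_2,\ldots,G_n$ ($n\ge 1$) be a finite sequence of pairwise disjoint connected graphs and let $x_i,y_i\in V(G_i)$ for $i=1,\ldots,n$. Let $C(G_1,\ldots,G_n)$ be the chain of the graphs $\{G_i\}_{i=1}^n$ with respect to the vertices $\{x_i,y_i\}_{i=1}^n$, i.e. the graph obtained from the disjoint union of $G_1,\ldots,G_n$ by identifying the vertex $y_i$ with the vertex $x_{i+1}$ for $i=1,2,\ldots,n-1$. Then $$\left(\sum_{i=1}^{n}\gamma_{sp}(G_i)\right)-n\leq \gamma_{sp}(C(G_1,\ldots,G_n))\leq \sum_{i=1}^{n}\gamma_{sp}(G_i).$$
   Context: All graphs are finite, simple and undirected. $N(v)$ denotes the open neighbourhood of $v$. For a graph $G=(V,E)$ and $S\subseteq V$ write $\overline{S}=V\setminus S$. A set $S\subseteq V$ is dominating if every vertex of $\overline{S}$ is adjacent to at least one vertex of $S$. A dominating set $S$ is a super dominating set of $G$ if for every $u\in\overline{S}$ there exists $w\in S$ with $N(w)\cap\overline{S}=\{u\}$. The super domination number $\gamma_{sp}(G)$ is the minimum cardinality of a super dominating set of $G$. *)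

(* Defs.v *)
From HB Require Import structures.
From mathcomp Require Import all_boot all_order all_algebra.

Set Implicit Arguments.
Unset Strict Implicit.
Unset Printing Implicit Defensive.

Local Open Scope quotient_scope.

Record sgraph := SGraph {
  vertex :> finType;
  adj : rel vertex;
  adj_sym : symmetric adj;
  adj_irrefl : irreflexive adj
}.

Section Domination.
Variable G : sgraph.
Implicit Types (S : {set G}) (u v w : G).

Definition neighbourhood v : {set G} := [set w | adj v w].

Definition connected_graph : bool :=
  (0 < #|G|) && [forall u : G, forall v : G, connect (@adj G) u v].

Definition dominating S : bool :=
  [forall v in ~: S, exists w in S, adj v w].

Definition super_dominating S : bool :=
  dominating S &&
  [forall u in ~: S, exists w in S, neighbourhood w :&: ~: S == [set u]].

Lemma super_dominatingT : super_dominating [set: G].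
Proof. by apply/andP; split; apply/forall_inP => u; rewrite !inE. Qed.

Definition gamma_sp : nat :=
  #|[arg min_(S < [set: G] | super_dominating S) #|S|]|.

Lemma gamma_sp_min :
  (exists2 S, super_dominating S & #|S| = gamma_sp) /\
  (forall S, super_dominating S -> gamma_sp <= #|S|).
Proof.
by rewrite /gamma_sp; case: arg_minnP; [exact: super_dominatingT|move=> S; eauto].
Qed.

End Domination.

Section DisjointUnion.
Variables (I : finType) (G : I -> sgraph).

Definition union_adj (u v : {i : I & G i}) : bool :=
  (tag u == tag v) && adj (tagged u) (tagged_as u v).

Lemma union_adj_sym : symmetric union_adj.
Proof.
move=> [i u] [j v]; rewrite /union_adj /= [j == i]eq_sym.
case: eqP => //= eq_ij; case: _ / eq_ij v => v.
by rewrite !tagged_asE adj_sym.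
Qed.

Lemma union_adj_irrefl : irreflexive union_adj.
Proof. by move=> [i u]; rewrite /union_adj /= tagged_asE adj_irrefl andbF. Qed.

Definition disjoint_union : sgraph := SGraph union_adj_sym union_adj_irrefl.

End DisjointUnion.

Section Identification.
Variables (G : sgraph) (r : rel G).

Definition generated_equiv : rel G := connect (fun u v => r u v || r v u).

Lemma generated_equiv_class_of : equiv_class_of generated_equiv.
Proof.
split; [exact: connect0 | | by move=> v u w; exact: connect_trans].
by apply: sym_connect_sym => u v; rewrite orbC.
Qed.

Canonical generated_equivRel := EquivRelPack generated_equiv_class_of.

(* quot_type is the identity on carriers; it carries the finType structure that
   quotients of a finType inherit. *)
Definition identified : finType := quot_type {eq_quot generated_equiv}.

Definition identify_class (u : G) : identified :=
  \pi_{eq_quot generated_equiv} u.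

Lemma identify_classP (u v : G) :
  reflect (identify_class u = identify_class v) (generated_equiv u v).
Proof. by apply: (iffP idP) => /(@eqmodP _ generated_equivRel). Qed.

Lemma identify_class_surj (a : identified) : exists u, identify_class u = a.
Proof. by exists (repr (a : {eq_quot generated_equiv})); exact: reprK. Qed.

(* The result is kept simple: parallel edges are merged, and an edge joining two
   identified vertices is deleted. Neither situation arises in a chain, where
   distinct vertices of one G_i are never identified. *)
Definition identified_adj (a b : identified) : bool :=
  (a != b) &&
  [exists u : G, exists v : G,
     [&& identify_class u == a, identify_class v == b & adj u v]].

Lemma identified_adj_sym : symmetric identified_adj.
Proof.
have sub a b : identified_adj a b -> identified_adj b a.
  case/andP=> ab /existsP[u /existsP[v /and3P[ua vb uv]]].
  rewrite /identified_adj eq_sym ab /=.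
  by apply/existsP; exists v; apply/existsP; exists u; rewrite ua vb adj_sym.
by move=> a b; apply/idP/idP; exact: sub.
Qed.

Lemma identified_adj_irrefl : irreflexive identified_adj.
Proof. by move=> a; rewrite /identified_adj eqxx. Qed.

Definition identify : sgraph := SGraph identified_adj_sym identified_adj_irrefl.

End Identification.

Section Chain.
Variables (n : nat) (G : 'I_n -> sgraph) (x y : forall i : 'I_n, G i).

(* u is y_i and v is x_(i+1), for some i with both i and i+1 in 'I_n. *)
Definition chain_link (u v : disjoint_union G) : bool :=
  [&& val (tag v) == (tag u).+1,
      tagged u == y (tag u) & tagged v == x (tag v)].

Definition chain : sgraph := identify chain_link.

End Chain.

(* Main.v *)
Require Import Defs.
From mathcomp Require Import all_boot all_order all_algebra.
From mathcomp Require Import zify.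

(** A super dominating set [S] together with its witnesses [u |-> w] is the same
    thing as a set of pairs [(u, w)] whose first and second components are
    disjoint and between which the only edges are those joining the two
    components of a pair.  Hence [gamma_sp G = #|G| - nu G], where [nu] is the
    largest number of pairs, and exchanging the two components preserves such
    families.  When two graphs are glued at a vertex [v], every pair lies in one
    of them, so [nu] is subadditive.  Conversely the union of two families is a
    family after removing one pair containing [v]; if both contain [v], the
    exchange lets us assume that [v] is a second component in both.  As the
    gluing also loses one vertex, induction along the chain gives the bounds. *)

Set Implicit Arguments.
Unset Strict Implicit.
Unset Printing Implicit Defensive.

(** * Families of pairs and super dominating sets *)

Section CrossMatching.
Variable G : sgraph.
Implicit Types (U W S : {set G}) (M N : {set G * G}) (p q : G * G).

(** Edges among first components, or among second ones, are unrestricted. The set [U] stands for the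
    subgraph it induces, so that pieces of one graph can be compared inside it. *)
Definition cross_matching U M : bool :=
  [forall p in M, [&& p.1 \in U, p.2 \in U &
    [forall q in M, (p.1 != q.2) && (adj p.1 q.2 == (p == q))]]].

Lemma cross_matchingP U M :
  reflect [/\ forall p, p \in M -> p.1 \in U /\ p.2 \in U
            & forall p q, p \in M -> q \in M ->
                p.1 != q.2 /\ adj p.1 q.2 = (p == q)]
          (cross_matching U M).
Proof.
apply: (iffP forall_inP) => [H | [HU HM] p pM].
  split=> [p /H/and3P[] // | p q /H/and3P[_ _ /forall_inP Hp] /Hp].
  by case/andP=> ? /eqP.
case: (HU p pM) => -> -> /=; apply/forall_inP => q qM.
by case: (HM p q pM qM) => -> ->; rewrite eqxx.
Qed.

(** If [p.1 = q.1], then [p.1] is adjacent to [q.2], which forces [p = q]. *)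
Lemma cross_matching_inj1 U M :
  cross_matching U M -> {in M &, injective (fun p => p.1)}.
Proof.
case/cross_matchingP=> _ HM p q pM qM /= pq.
have [_] := HM p q pM qM.
by rewrite pq (HM q q qM qM).2 eqxx => /esym/eqP.
Qed.

Lemma cross_matching_inj2 U M :
  cross_matching U M -> {in M &, injective (fun p => p.2)}.
Proof.
case/cross_matchingP=> _ HM p q pM qM /= pq.
have [_] := HM p q pM qM.
by rewrite -pq (HM p p pM pM).2 eqxx => /esym/eqP.
Qed.

Lemma cross_matching_sub U W M N :
  N \subset M -> (forall p, p \in N -> p.1 \in W /\ p.2 \in W) ->
  cross_matching U M -> cross_matching W N.
Proof.
move=> /subsetP NM NW /cross_matchingP[_ HM].
by apply/cross_matchingP; split=> // p q /NM pM /NM; exact: HM.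
Qed.

Definition flip p : G * G := (p.2, p.1).

Lemma flipK : involutive flip. Proof. by case. Qed.

Lemma cross_matching_flip U M :
  cross_matching U M -> cross_matching U (flip @: M).
Proof.
case/cross_matchingP=> HU HM; apply/cross_matchingP; split.
  by move=> _ /imsetP[p /HU[p1 p2] ->].
move=> _ _ /imsetP[p pM ->] /imsetP[q qM ->] /=.
rewrite (inj_eq (can_inj flipK)) [p == q]eq_sym adj_sym eq_sym.
exact: HM.
Qed.

Definition nu U : nat := \max_(M | cross_matching U M) #|M|.

Lemma nu_attained U : exists2 M, cross_matching U M & #|M| = nu U.
Proof.
have M0 : cross_matching U set0.
  by apply/forall_inP => p; rewrite inE.
have nonempty : 0 < #|cross_matching U| by apply/card_gt0P; exists set0.
have [M MM cM] := eq_bigmax_cond (fun M => #|M|) nonempty.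
by exists M.
Qed.

Lemma nu_max U M : cross_matching U M -> #|M| <= nu U.
Proof. exact: leq_bigmax_cond. Qed.

Lemma super_dominating_nu S : super_dominating S -> #|~: S| <= nu [set: G].
Proof.
case/andP=> _ /forall_inP HS.
(* The default [u] is never reached for [u] outside [S], where a witness exists. *)
pose f u := odflt u [pick w in S | neighbourhood w :&: ~: S == [set u]].
have fP u : u \in ~: S -> f u \in S /\ neighbourhood (f u) :&: ~: S = [set u].
  move=> uS; rewrite /f; case: pickP => [w /andP[? /eqP] // | none].
  by have /exists_inP[w wS wu] := HS u uS; have := none w; rewrite wS wu.
have inj : injective (fun u => (u, f u)) by move=> u v [].
rewrite -(card_imset _ inj); apply: nu_max.
apply/cross_matchingP; split=> [p _ | _ _ /imsetP[u uS ->] /imsetP[v vS ->]] /=.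
  by rewrite !inE.
have [fS fv] := fP v vS; split.
  by apply: contraTneq uS => ->; rewrite inE fS.
rewrite (inj_eq inj); have := in_set1 u v; rewrite -fv !inE adj_sym => <-.
by move: uS; rewrite inE => ->; rewrite andbT.
Qed.

(** The witness for [p.1] is [p.2]: it is no first component, and its only neighbour among them is
    [p.1]. *)
Lemma cross_matching_super_dominating U M :
  cross_matching U M -> super_dominating (~: [set p.1 | p in M]).
Proof.
case/cross_matchingP=> _ HM; rewrite /super_dominating /dominating setCK.
have wit p : p \in M -> p.2 \in ~: [set p.1 | p in M].
  move=> pM; rewrite inE; apply/imsetP => -[q qM] /esym/eqP.
  by rewrite (negPf (HM q p qM pM).1).
apply/andP; split; apply/forall_inP => _ /imsetP[p pM ->]; apply/exists_inP;
  exists p.2; rewrite ?wit //; first by rewrite (HM p p pM pM).2 eqxx.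
apply/eqP/setP=> u; rewrite !inE; apply/andP/eqP.
  case=> + /imsetP[q qM uq]; rewrite uq adj_sym (HM q p qM pM).2.
  by move/eqP->.
move=> ->; rewrite adj_sym (HM p p pM pM).2 eqxx; split=> //.
by apply/imsetP; exists p.
Qed.

Lemma gamma_sp_nu : gamma_sp G + nu [set: G] = #|G|.
Proof.
have [[S SD cS] Smin] := gamma_sp_min G.
have [M MM cM] := nu_attained [set: G].
have := super_dominating_nu SD; have := cardsC S.
have := Smin _ (cross_matching_super_dominating MM).
have := cardsC [set p.1 | p in M].
rewrite (card_in_imset (cross_matching_inj1 MM)); lia.
Qed.

(** * Gluing two pieces at a single vertex *)

Section Gluing.
Variables (U W : {set G}) (v : G).
Hypothesis UW : U :&: W = [set v].
Hypothesis UW_edge : forall a b, adj a b -> a \in U :|: W -> b \in U :|: W ->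
  (a \in U /\ b \in U) \/ (a \in W /\ b \in W).

(** The components of a pair are adjacent, so by [UW_edge] each pair lies within [U] or within
    [W]. *)
Lemma nu_glue_le : nu (U :|: W) <= nu U + nu W.
Proof.
have [M MM <-] := nu_attained (U :|: W).
have [HU HM] := cross_matchingP _ _ MM.
pose MU := [set p in M | (p.1 \in U) && (p.2 \in U)].
pose MW := [set p in M | (p.1 \in W) && (p.2 \in W)].
have -> : M = MU :|: MW.
  apply/setP => p; rewrite !inE -andb_orr; have [pM /=|//] := boolP (p \in M).
  have [p1 p2] := HU p pM.
  have e : adj p.1 p.2 by rewrite (HM p p pM pM).2.
  by case: (UW_edge e p1 p2) => -[-> ->]; rewrite ?orbT.
apply: leq_trans (leq_card_setU _ _) _.
apply: leq_add; apply: nu_max; apply: cross_matching_sub MM;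
  by [apply/subsetP => p; rewrite inE => /andP[]
     | move=> p; rewrite inE => /and3P[]].
Qed.

Lemma glue_noncrossing a b :
  a \in U -> b \in W -> a != v -> b != v -> a != b /\ adj a b = false.
Proof.
move=> aU bW av bv.
have aW : a \notin W.
  by apply: contraNN av => aW; rewrite -in_set1 -UW inE aU aW.
have bU : b \notin U.
  by apply: contraNN bv => bU; rewrite -in_set1 -UW inE bU bW.
split; first by apply: contraNneq aW => ->.
apply/negP => /UW_edge; rewrite !inE aU bW orbT => /(_ isT isT).
by rewrite (negPf aW) (negPf bU) => -[[]|[]].
Qed.

Lemma cross_matching_union M N :
    cross_matching U M -> cross_matching W N ->
    (forall p q, p \in M -> q \in N -> [/\ p.1 != q.2, adj p.1 q.2 = false,
       q.1 != p.2 & adj q.1 p.2 = false]) ->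
  #|M| + #|N| <= nu (U :|: W).
Proof.
move=> MM NN cross.
have [HU HM] := cross_matchingP _ _ MM; have [HW HN] := cross_matchingP _ _ NN.
(* A pair common to both families would have components both adjacent and, by [cross], non-adjacent.
   Hence the two sizes add up. *)
have disj p q : p \in M -> q \in N -> p != q.
  move=> pM qN; apply: contraTneq (qN) => <-; apply/negP => pN.
  by have [_] := cross p p pM pN; rewrite (HM p p pM pM).2 eqxx.
rewrite -[#|M| + #|N|]subn0.
have <- : #|M :&: N| = 0.
  apply/eqP; rewrite cards_eq0 -subset0; apply/subsetP => p.
  by rewrite inE => /andP[pM /(disj p p pM)]; rewrite eqxx.
rewrite -cardsU; apply: nu_max; apply/cross_matchingP; split=> [p|p q].
  by rewrite !inE => /orP[/HU|/HW] [-> ->]; rewrite ?orbT.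
rewrite !inE => /orP[pM|pN] /orP[qM|qN].
- exact: HM.
- by have [-> -> _ _] := cross p q pM qN; rewrite (negPf (disj p q pM qN)).
- have [_ _ -> ->] := cross q p qM pN.
  by rewrite eq_sym (negPf (disj q p qM pN)).
- exact: HN.
Qed.

Definition avoids M := forall p, p \in M -> p.1 != v /\ p.2 != v.

(** If [v] occurs as a first component, the whole family is flipped; its size does not change. *)
Lemma avoids_or_snd X M : cross_matching X M -> avoids M \/
  exists N, [/\ cross_matching X N, #|N| = #|M| & exists2 p, p \in N & p.2 = v].
Proof.
move=> MM; have [/exists_inP[p pM /orP pv] | none] :=
  boolP [exists p in M, (p.1 == v) || (p.2 == v)]; last first.
  left=> p pM; move: none; rewrite negb_exists_in => /forall_inP/(_ p pM).
  by rewrite negb_or => /andP.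
right; case: pv => /eqP pv; last by exists M; split=> //; exists p.
exists (flip @: M); split; first exact: cross_matching_flip.
  exact/card_imset/(can_inj flipK).
by exists (flip p); rewrite ?imset_f.
Qed.

(** No first component equals [v], since first and second components are disjoint, and second
    components are distinct; so [p] is the only pair containing [v]. *)
Lemma snd_removed_avoids X M p : cross_matching X M -> p \in M -> p.2 = v ->
  [/\ cross_matching X (M :\ p), avoids (M :\ p) & #|M| = #|M :\ p|.+1].
Proof.
move=> MM pM pv; have [HX HM] := cross_matchingP _ _ MM; split.
- apply: cross_matching_sub (subD1set M p) _ MM => q.
  by rewrite inE => /andP[_ /HX].
- move=> q; rewrite !inE => /andP[qp qM]; rewrite -pv (HM q p qM pM).1; split=> //.
  by apply: contraNneq qp => /(cross_matching_inj2 MM qM pM) ->.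
- by rewrite (cardsD1 p) pM.
Qed.

Lemma avoids_union M N :
    cross_matching U M -> cross_matching W N -> avoids M -> avoids N ->
  #|M| + #|N| <= nu (U :|: W).
Proof.
move=> MM NN Mv Nv; apply: cross_matching_union => // p q pM qN.
have [HU _] := cross_matchingP _ _ MM; have [HW _] := cross_matchingP _ _ NN.
have [[p1 p2] [q1 q2]] := (HU p pM, HW q qN).
have [[p1v p2v] [q1v q2v]] := (Mv p pM, Nv q qN).
have [-> ->] := glue_noncrossing p1 q2 p1v q2v.
by have [] := glue_noncrossing p2 q1 p2v q1v; rewrite eq_sym adj_sym => -> ->.
Qed.

Lemma nu_glue_ge : nu U + nu W <= (nu (U :|: W)).+1.
Proof.
have [M MM <-] := nu_attained U; have [N NN <-] := nu_attained W.
have [Mv | [M' [MM' <- [p pM pv]]]] := avoids_or_snd MM;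
  have [Nv | [N' [NN' <- [q qN qv]]]] := avoids_or_snd NN.
- exact/leqW/avoids_union.
- have [NN1 Nv ->] := snd_removed_avoids NN' qN qv.
  by rewrite addnS ltnS avoids_union.
- have [MM1 Mv ->] := snd_removed_avoids MM' pM pv.
  by rewrite addSn ltnS avoids_union.
(* Both families have [v] as a second component: only [q] is removed and [p] stays. *)
have [NN1 Nv ->] := snd_removed_avoids NN' qN qv.
rewrite addnS ltnS; apply: cross_matching_union => // r s rM sN.
have [HU HM] := cross_matchingP _ _ MM'; have [HW HN] := cross_matchingP _ _ NN'.
have [s1v s2v] := Nv s sN.
move: sN; rewrite !inE => /andP[sq sN].
have [[r1 r2] [s1 s2]] := (HU r rM, HW s sN).
have r1v : r.1 != v by rewrite -pv; case: (HM r p rM pM).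
have [-> ->] := glue_noncrossing r1 s2 r1v s2v.
(* If [r.2 = v = q.2], then [s.1] is not adjacent to it because [s] and [q] are distinct pairs of
   [N']. *)
have [r2v | r2v] := eqVneq r.2 v.
  by rewrite r2v s1v -qv (HN s q sN qN).2 (negPf sq).
by have [] := glue_noncrossing r2 s1 r2v s1v; rewrite eq_sym adj_sym => -> ->.
Qed.

End Gluing.

End CrossMatching.

(** * Invariance under induced embeddings *)

Lemma nu_embedding (G H : sgraph) (h : G -> H) :
    injective h -> (forall a b, adj (h a) (h b) = adj a b) ->
  nu (h @: [set: G]) = nu [set: G].
Proof.
move=> h_inj h_adj; pose h2 (p : G * G) := (h p.1, h p.2).
have h2_inj : injective h2 by move=> [a b] [c d] [/h_inj -> /h_inj ->].
apply/eqP; rewrite eqn_leq; apply/andP; split.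
  have [M MM <-] := nu_attained (h @: [set: G]).
  have [HU HM] := cross_matchingP _ _ MM.
  (* All components lie in the image of [h], so pulling [M] back loses no pair. *)
  have <- : h2 @: (h2 @^-1: M) = M.
    apply/setP => p; apply/imsetP/idP => [[q] | pM].
      by rewrite inE => ? ->.
    have [/imsetP[a _ pa] /imsetP[b _ pb]] := HU p pM.
    have pE : p = h2 (a, b) by rewrite /h2 -pa -pb; case: (p).
    by exists (a, b); rewrite // inE -pE.
  rewrite (card_imset _ h2_inj); apply: nu_max; apply/cross_matchingP.
  split=> [p _ | p q]; first by rewrite !inE.
  rewrite !inE => pM qM; have := HM _ _ pM qM.
  by rewrite /= h_adj (inj_eq h_inj) (inj_eq h2_inj).
have [M MM <-] := nu_attained [set: G].
have [_ HM] := cross_matchingP _ _ MM.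
rewrite -(card_imset _ h2_inj); apply: nu_max; apply/cross_matchingP; split.
  by move=> _ /imsetP[p _ ->]; rewrite /= !imset_f ?inE.
move=> _ _ /imsetP[p pM ->] /imsetP[q qM ->].
by rewrite /= h_adj (inj_eq h_inj) (inj_eq h2_inj); exact: HM.
Qed.

(** This default value is what makes [retract k] send every part before [G k] to [x k]. *)
Lemma tagged_as_neq (I : eqType) (T_ : I -> Type) (u v : {i : I & T_ i}) :
  tag u != tag v -> tagged_as u v = tagged u.
Proof. by rewrite /tagged_as; case: eqP. Qed.

(** * The graphs inside the chain, and induction along it *)

Section ChainStructure.
Variables (n : nat) (G : 'I_n -> sgraph) (x y : forall i : 'I_n, G i).

Definition inj_part (i : 'I_n) (a : G i) : chain x y :=
  @identify_class (disjoint_union G) (chain_link x y) (Tagged G a).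

(* Collapses the part of the chain before [G k] to [x k] and the part after it
   to [y k]. *)
Definition retract (k : 'I_n) (u : disjoint_union G) : G k :=
  if k < tag u then y k else tagged_as (Tagged G (x k)) u.

(** Let the link join [y i] to [x j] with [j = i + 1]. Both ends go to [x k] if [j <= k], and both
    to [y k] if [k <= i]. *)
Lemma retract_link k u v : chain_link x y u v -> retract k u = retract k v.
Proof.
case: u v => [i a] [j b] /and3P[/= /eqP ji /eqP -> /eqP ->].
rewrite /retract /= ji ltnS.
have [<-|ik] := eqVneq i k; first by rewrite ltnn leqnn tagged_asE.
have [jk|jk] := eqVneq j k.
  rewrite -jk in ik *.
  by rewrite ji ltnn ltnNge leqW //= tagged_asE tagged_as_neq //= eq_sym.
rewrite [k <= i]leq_eqVlt eq_sym [nat_of_ord i == k]val_eqE (negPf ik) /=.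
by rewrite !tagged_as_neq //= eq_sym.
Qed.

Lemma retract_class k u v :
  @identify_class (disjoint_union G) (chain_link x y) u = identify_class _ v ->
  retract k u = retract k v.
Proof.
move/identify_classP => /connectP[p]; elim: p u => [|w p IH] u /=.
  by move=> _ ->.
case/andP=> uw /IH H /H <-.
by case/orP: uw => /(retract_link k).
Qed.

(** [retract i] respects the identification and is a left inverse. *)
Lemma inj_part_inj i : injective (@inj_part i).
Proof.
by move=> a b /(retract_class i); rewrite /retract /= ltnn !tagged_asE.
Qed.

Lemma inj_part_lt i j (a : G i) (b : G j) :
  i < j -> inj_part a = inj_part b -> b = x j.
Proof.
move=> ij /(retract_class j); rewrite /retract /= ltnn ltnNge (ltnW ij) /=.
by rewrite tagged_asE tagged_as_neq //= -val_eqE gtn_eqF.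
Qed.

Lemma inj_part_gt i j (a : G i) (b : G j) :
  j < i -> inj_part a = inj_part b -> b = y j.
Proof.
by move=> ji /(retract_class j); rewrite /retract /= ltnn ji tagged_asE.
Qed.

Lemma chain_adjP (p q : chain x y) : adj p q ->
  exists i (a b : G i), [/\ p = inj_part a, q = inj_part b & adj a b].
Proof.
case/andP=> _ /existsP[[i a] /existsP[[j b] /and3P[/eqP <- /eqP <-]]].
case/andP=> /= /eqP ij; case: _ / ij b => b.
by rewrite tagged_asE; exists i, a, b.
Qed.

(** An edge of the chain comes from some [G j]. If [j] differs from [i], both of its ends in [G j]
    equal [x j], or both equal [y j], which would be a loop. *)
Lemma inj_part_adj i (a b : G i) : adj (inj_part a) (inj_part b) = adj a b.
Proof.
apply/idP/idP => [/chain_adjP[j [c [d [ac bd cd]]]] | ab].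
  have [ij | ji | ij] := ltngtP i j.
  - by rewrite (inj_part_lt ij ac) (inj_part_lt ij bd) adj_irrefl in cd.
  - by rewrite (inj_part_gt ji ac) (inj_part_gt ji bd) adj_irrefl in cd.
  have {}ij := val_inj ij; case: _ / ij c d ac bd cd => c d.
  by move=> /inj_part_inj -> /inj_part_inj ->.
apply/andP; split.
  rewrite (inj_eq (@inj_part_inj i)).
  by apply: contraTneq ab => ->; rewrite adj_irrefl.
apply/existsP; exists (Tagged G a); apply/existsP; exists (Tagged G b).
by rewrite !eqxx /= /union_adj /= eqxx tagged_asE.
Qed.

Definition part i : {set chain x y} := @inj_part i @: [set: G i].

Definition initial (k : nat) : {set chain x y} :=
  \bigcup_(i < n | i <= k) part i.

Lemma mem_initial k (p : chain x y) :
  reflect (exists i (a : G i), i <= k /\ p = inj_part a) (p \in initial k).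
Proof.
apply: (iffP bigcupP) => [[i ik /imsetP[a _ ->]] | [i [a [ik ->]]]].
  by exists i, a.
by exists i => //; apply: imset_f.
Qed.

Lemma initial_last k : n = k.+1 -> initial k = [set: chain x y].
Proof.
move=> nk; apply/setP => p; rewrite inE; apply/mem_initial.
have [[i a] <-] := identify_class_surj p.
by exists i, a; rewrite -ltnS -nk ltn_ord.
Qed.

Lemma initialS k (kn : k.+1 < n) :
  initial k.+1 = initial k :|: part (Ordinal kn).
Proof.
rewrite /initial (bigD1 (Ordinal kn)) //= setUC; congr (_ :|: _).
by apply: eq_bigl => i; rewrite -val_eqE /=; lia.
Qed.

Lemma initial_part k (kn : k.+1 < n) :
  initial k :&: part (Ordinal kn) = [set inj_part (x (Ordinal kn))].
Proof.
apply/setP => p; rewrite in_setI in_set1; apply/andP/eqP => [[] | ->].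
  move=> /mem_initial[i [a [ik pa]]] /imsetP[b _ pb].
  by rewrite pb -(@inj_part_lt i _ a b) // -pa.
split; last exact: imset_f.
(* The gluing vertex is also the [y] of the graph with index [k]. *)
apply/mem_initial; exists (Ordinal (ltnW kn)), (y _); split=> //.
apply/esym/identify_classP/connect1.
by rewrite /chain_link /= !eqxx.
Qed.

Lemma initial_edge k (kn : k.+1 < n) (p q : chain x y) :
    adj p q -> p \in initial k :|: part (Ordinal kn) ->
    q \in initial k :|: part (Ordinal kn) ->
  (p \in initial k /\ q \in initial k) \/
  (p \in part (Ordinal kn) /\ q \in part (Ordinal kn)).
Proof.
rewrite -initialS => /chain_adjP[i [a [b [-> -> ab]]]].
have [ik _ _|] := leqP i k.
  by left; split; apply/mem_initial; [exists i, a | exists i, b].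
rewrite leq_eqVlt => /orP[/eqP ki _ _|ki].
  have -> : Ordinal kn = i by exact: val_inj.
  by right; split; apply: imset_f.
(* The edge lies in a part beyond [k.+1], while both ends also lie in earlier parts; both are then
   [x i], a loop. *)
case/mem_initial=> j [c [jk ac]] /mem_initial[l [d [lk bd]]].
rewrite (inj_part_lt (leq_ltn_trans jk ki) (esym ac)) in ab.
by rewrite (inj_part_lt (leq_ltn_trans lk ki) (esym bd)) adj_irrefl in ab.
Qed.

Lemma nu_part i : nu (part i) = nu [set: G i].
Proof. exact: nu_embedding (@inj_part_inj i) (@inj_part_adj i). Qed.

Lemma card_part i : #|part i| = #|G i|.
Proof. by rewrite (card_imset _ (@inj_part_inj i)) cardsT. Qed.

(** Reaching [initial k] takes [k] gluings; each loses exactly one vertex and at most one pair. *)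
Lemma initial_bounds k : k < n ->
  [/\ #|initial k| + k = \sum_(i < n | i <= k) #|G i|,
      nu (initial k) <= \sum_(i < n | i <= k) nu [set: G i]
    & \sum_(i < n | i <= k) nu [set: G i] <= nu (initial k) + k].
Proof.
elim: k => [kn|k IH kn].
  have only0 : (fun i : 'I_n => i <= 0) =1 pred1 (Ordinal kn).
    by move=> i; rewrite /= -val_eqE /= leqn0.
  rewrite /initial !(eq_bigl _ _ only0) !big_pred1_eq.
  by rewrite card_part nu_part !addn0 leqnn.
have split_last F : \sum_(i < n | i <= k.+1) F i =
    F (Ordinal kn) + \sum_(i < n | i <= k) F i.
  rewrite (bigD1 (Ordinal kn)) //=; congr (_ + _).
  by apply: eq_bigl => i; rewrite -val_eqE /=; lia.
have [cI leI geI] := IH (ltnW kn).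
have := nu_glue_le (@initial_edge k kn).
have := nu_glue_ge (initial_part kn) (@initial_edge k kn).
have := cardsU (initial k) (part (Ordinal kn)).
(* This keeps the truncated subtraction in [cardsU] exact. *)
have : 0 < #|initial k :&: part (Ordinal kn)| <= #|part (Ordinal kn)|.
  by rewrite subset_leq_card ?subsetIr // initial_part cards1.
rewrite initial_part cards1 -initialS !split_last nu_part card_part.
by move=> *; split; lia.
Qed.

End ChainStructure.

(** * From pair counts back to super domination numbers *)

Theorem corollary3p4 (n : nat) (hn : (1 <= n)%N) (G : 'I_n -> sgraph)
    (x y : forall i : 'I_n, G i)
    (hG : forall i : 'I_n, connected_graph (G i)) :
  ((\sum_(i < n) (gamma_sp (G i))%:Z) - n%:Z <= (gamma_sp (chain x y))%:Z)%R /\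
  ((gamma_sp (chain x y))%:Z <= \sum_(i < n) (gamma_sp (G i))%:Z)%R.
Proof.
case: n hn G x y {hG} => // n _ G x y.
rewrite -(big_morph _ PoszD (erefl _)) Num.Theory.lerBlDr -PoszD !lez_nat.
have all_le F : \sum_(i < n.+1 | i <= n) F i = \sum_(i < n.+1) F i.
  by apply: eq_bigl => i; rewrite -ltnS ltn_ord.
have sum_card : \sum_(i < n.+1) #|G i| =
    \sum_(i < n.+1) gamma_sp (G i) + \sum_(i < n.+1) nu [set: G i].
  by rewrite -big_split; apply: eq_bigr => i _; rewrite /= gamma_sp_nu.
(* There are now [n.+1] graphs, hence [n] gluings. With [gamma_sp_nu], the vertex count reads
   [gamma_sp (chain x y) + nu [set: chain x y] + n = sum_gamma + sum_nu]. The two bounds on [sum_nu]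
   then give the two inequalities. *)
have [] := initial_bounds x y (ltnSn n).
rewrite !all_le (initial_last x y (erefl n.+1)) cardsT -gamma_sp_nu sum_card.
set sum_gamma := \sum_i _; set sum_nu := \sum_i _.
by move=> *; split; lia.
Qed.
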